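(* Let $J\geq2$ be an integer, let $\mathrm{B}$ be a symplectic form on a vector space $\mathcal{V}$ over $\mathbb{F}_2$ of dimension $2J$, and let $\mathcal{D}$ be an affine quadric in $\mathcal{V}$ with $\#(\mathcal{D})=2^{J-1}(2^J+1)$ and complement $\mathcal{D}^{\mathrm{c}}$. Let $\Phi$ and $\Phi_{\mathcal{D}^{\mathrm{c}}}$ be the ETFs defined in the context. Then $\operatorname{bin}(\Phi_{\mathcal{D}^{\mathrm{c}}})$ is empty unless $J=2$. When $J=2$, $\Phi_{\mathcal{D}^{\mathrm{c}}}$ is a $6$-vector regular simplex and so $\operatorname{bin}(\Phi_{\mathcal{D}^{\mathrm{c}}})=\{\mathcal{D}^{\mathrm{c}}\}$, while $\operatorname{bin}(\Phi)$ consists of all shifts $v+\mathcal{D}^{\mathrm{c}}$ ($v\in\mathcal{V}$) of $\mathcal{D}^{\mathrm{c}}$, which forms a BIBD with parameters $(V,K,\Lambda,R,B)=(16,6,2,6,16)$.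
   Context: A symplectic form is an alternating nondegenerate bilinear form. A function $\mathrm{Q}:\mathcal{V}\to\mathbb{F}_2$ is a quadratic form that yields $\mathrm{B}$ if $\mathrm{B}(v_1,v_2)=\mathrm{Q}(v_1+v_2)+\mathrm{Q}(v_1)+\mathrm{Q}(v_2)$ for all $v_1,v_2\in\mathcal{V}$; its quadric is $\{v\in\mathcal{V}:\mathrm{Q}(v)=0\}$. A subset $\mathcal{D}\subseteq\mathcal{V}$ is an affine quadric if either $\mathcal{D}$ or its complement is the quadric of some quadratic form that yields $\mathrm{B}$. ETFs: a finite sequence $(\varphi_n)_{n\in\mathcal{N}}$ in a real Hilbert space ($\mathcal{N}$ finite, nonempty) is an equiangular tight frame (ETF) if $\|\varphi_n\|^2=S$ for all $n$ for some $S>0$, $|\langle\varphi_{n_1},\varphi_{n_2}\rangle|^2=C$ for all $n_1\neq n_2$ for some $C>0$, and for some $A>0$, $\sum_n\langle\varphi_n,y\rangle\varphi_n=Ay$ for all $y$ in its span. For nonempty $\mathcal{K}\subseteq\mathcal{N}$, $(\varphi_n)_{n\in\mathcal{K}}$ is a regular simplex if it is an ETF whose span has dimension $\#(\mathcal{K})-1$. The binder $\operatorname{bin}(\Phi)$ of an ETF $\Phi=(\varphi_n)_{n\in\mathcal{N}}$ is the set of all $\mathcal{K}\subseteq\mathcal{N}$ such that $(\varphi_n)_{n\in\mathcal{K}}$ is a regular simplex. The sequences: $\Phi=(\varphi_v)_{v\in\mathcal{V}}$ in $\mathbb{R}^{\mathcal{D}}$ is given by $\varphi_{v_2}(v_1)=2^{-(J-1)/2}(-1)^{\mathrm{B}(v_1,v_2)}$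 for $v_1\in\mathcal{D}$, $v_2\in\mathcal{V}$, and $\Phi_{\mathcal{D}^{\mathrm{c}}}=(\varphi_v)_{v\in\mathcal{D}^{\mathrm{c}}}$. It is known that $\Phi$ is an ETF for $\mathbb{R}^{\mathcal{D}}$, and that $\Phi_{\mathcal{D}^{\mathrm{c}}}$ is a $2^{J-1}(2^J-1)$-vector ETF whose span has dimension $\frac13(2^{2J}-1)$, with $\langle\varphi_{v_1},\varphi_{v_2}\rangle=(-1)^{\mathrm{B}(v_1,v_2)}$ for distinct $v_1,v_2\in\mathcal{D}^{\mathrm{c}}$ and $\|\varphi_v\|^2=2^J+1$. BIBDs: a BIBD with parameters $(V,K,\Lambda,R,B)$ consists of a vertex set of size $V$ and a sequence of $B\geq1$ subsets (blocks), all of size $K\geq2$, such that any two distinct vertices are contained together in exactly $\Lambda$ blocks (and then every vertex lies in exactly $R$ blocks). A set of subsets forms a BIBD if an enumeration of it without repetition is the block sequence of a BIBD; here the vertex set is $\mathcal{V}$. *)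

(* Defs.v *)
From HB Require Import structures.
From mathcomp Require Import all_boot all_order all_fingroup all_algebra all_field.
From mathcomp Require Import boolp reals.

Set Implicit Arguments.
Unset Strict Implicit.
Unset Printing Implicit Defensive.

Import Order.TTheory GRing.Theory Num.Theory.
Local Open Scope ring_scope.

Section Quadrics.
Variable V : vectType 'F_2.
Local Notation fV := (finvect_type V).

Definition quadratic_form_yielding (Q : fV -> 'F_2) (B : fV -> fV -> 'F_2) :=
  forall v1 v2 : fV, B v1 v2 = Q (v1 + v2) + Q v1 + Q v2.

Definition quadric (Q : fV -> 'F_2) : {set fV} := [set v | Q v == 0].

Definition affine_quadric (B : fV -> fV -> 'F_2) (D : {set fV}) :=
  exists2 Q : fV -> 'F_2,
    quadratic_form_yielding Q B & D = quadric Q \/ ~: D = quadric Q.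

Definition shift (v : fV) (A : {set fV}) : {set fV} := [set v + x | x in A].

End Quadrics.

(* A sequence in R^I is a map phi : N -> {ffun I -> R^o}; its subsequences are
   given by subsets K of the index type N, so the predicates below speak of
   the sequence (phi n) for n in K. *)
Section Frames.
Variables (R : realType) (I N : finType).
Implicit Types (phi : N -> {ffun I -> R^o}) (K : {set N}).

Definition dot (x y : {ffun I -> R^o}) : R := \sum_i x i * y i.

Definition spanv phi K : {vspace {ffun I -> R^o}} :=
  <<[seq phi n | n in K]>>%VS.

Definition is_ETF phi K :=
  [/\ K != set0,
      exists2 S : R, 0 < S & {in K, forall n, dot (phi n) (phi n) = S},
      exists2 C : R, 0 < C &
        {in K &, forall n1 n2, n1 != n2 -> `|dot (phi n1) (phi n2)| ^+ 2 = C}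
    & exists2 A : R, 0 < A &
        {in spanv phi K, forall y,
           \sum_(n in K) dot (phi n) y *: phi n = A *: y}].

(* No truncation issue in #|K| - 1: an ETF is nonempty. *)
Definition regular_simplex phi K :=
  is_ETF phi K /\ \dim (spanv phi K) = (#|K| - 1)%N.

Definition binder phi (A : {set N}) : {set {set N}} :=
  [set K : {set N} | (K \subset A) && `[< regular_simplex phi K >]].

End Frames.

(* The sequence indexed by all of V, in R^D. The value of B in 'F_2 is used as
   an exponent through its representative 0 or 1, and the normalizing factor
   2^(-(J-1)/2) is written as an inverse power of sqrt 2. *)
Definition Phi (R : realType) (J : nat) (V : vectType 'F_2)
    (B : finvect_type V -> finvect_type V -> 'F_2)
    (D : {set finvect_type V}) (v2 : finvect_type V) :
    {ffun {v : finvect_type V | v \in D} -> R^o} :=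
  [ffun v1 => Num.sqrt 2 ^- (J - 1) * (-1) ^+ nat_of_ord (B (val v1) v2)].

Section Designs.
Variable T : finType.

Definition is_BIBD (v k l r b : nat) (blocks : seq {set T}) :=
  [/\ #|T| = v,
      size blocks = b /\ (1 <= b)%N,
      {in blocks, forall K : {set T}, #|K| = k} /\ (2 <= k)%N,
      forall x y : T, x != y ->
        count (fun K : {set T} => (x \in K) && (y \in K)) blocks = l
    & forall x : T, count (fun K : {set T} => x \in K) blocks = r].

Definition forms_BIBD (v k l r b : nat) (S : {set {set T}}) :=
  exists blocks : seq {set T},
    [/\ uniq blocks, blocks =i S & is_BIBD v k l r b blocks].

End Designs.

(* Main.v *)
(* Write D = {q = 0} with q(x+y) = q(x) + q(y) + q(0) + B(x,y).  Character sums
   give <phi_x, phi_y> = 2^J [x = y] + (-1)^(B(x,y) + q(x) + q(y)).  With squared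
   norm S = 2^J + 1 and inner products +-1, a subsequence K is a regular simplex
   iff #K = S + 1 and all triple products of distinct off-diagonal Gram entries
   are -1, i.e. B(x,y) + B(y,z) + B(x,z) = 1 on distinct x, y, z in K.
   Translating one point of K to 0 yields 2^J + 1 vectors with pairwise B = 1;
   2^J of them are linearly independent, so 2^J <= 2J and J = 2.  For J = 2, each
   nonzero v is the sum of exactly two ordered pairs in D^c, so no four distinct
   points of D^c sum to 0, which is the triple condition for D^c.  Conversely any K
   satisfying it is z + {0, e1, ..., e4, e1 + ... + e4} for a basis e1, ..., e4, and
   solving B(w, e_i) = q(e_i) + q(0) makes q constant on the translate of K by
   z + w. *)

Require Import Defs.
From HB Require Import structures.
From mathcomp Require Import all_boot all_order all_fingroup all_algebra all_field.
From mathcomp Require Import boolp reals.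
From mathcomp Require Import ring zify.

Set Implicit Arguments.
Unset Strict Implicit.
Unset Printing Implicit Defensive.

Import Order.TTheory GRing.Theory Num.Theory.
Local Open Scope ring_scope.

(** * Linear dependencies and Gram matrices of regular simplices *)

Section Simplices.
Variables (R : realType) (I N : finType) (phi : N -> {ffun I -> R^o}).
Variable K : {set N}.
Implicit Types (u v : {ffun I -> R^o}) (x y z : N) (a b : N -> R).

Lemma dotC u v : dot u v = dot v u.
Proof. by apply: eq_bigr => i _; rewrite mulrC. Qed.

Lemma dot_sumr u (A : {set N}) a :
  dot u (\sum_(n in A) a n *: phi n) = \sum_(n in A) a n * dot u (phi n).
Proof.
rewrite /dot; under eq_bigr do rewrite sum_ffunE mulr_sumr.
rewrite exchange_big /=; apply: eq_bigr => n _; rewrite mulr_sumr.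
by apply: eq_bigr => i _; rewrite ffunE mulrCA.
Qed.

Lemma dot0r u : dot u 0 = 0.
Proof. by rewrite /dot big1 // => i _; rewrite ffunE mulr0. Qed.

Lemma dot_eq0 u : dot u u = 0 -> u = 0.
Proof.
move=> /eqP; rewrite psumr_eq0 => [/allP x0|i _]; last by rewrite -expr2 sqr_ge0.
apply/ffunP => i; rewrite ffunE; apply/eqP.
by have := x0 i (mem_index_enum i); rewrite /= mulf_eq0 orbb.
Qed.

Lemma spanv_mem (A : {set N}) n : n \in A -> phi n \in spanv phi A.
Proof. by move=> nA; apply: memv_span; rewrite map_f // mem_enum. Qed.

Lemma spanvP (A : {set N}) u :
  u \in spanv phi A -> exists a, u = \sum_(n in A) a n *: phi n.
Proof.
move=> uA; suff [a ->] : exists a, u = \sum_(n <- enum A) a n *: phi n.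
  by exists a; rewrite big_enum.
move: u uA; rewrite /spanv /image_mem.
elim: (enum A) (enum_uniq A) => [|m s IHs] /=.
  by move=> _ y; rewrite span_nil memv0 => /eqP ->; exists (fun=> 0); rewrite big_nil.
move=> /andP[ms us] y; rewrite span_cons => /memv_addP[u /vlineP[k ->]] [v vs ->].
have [a ->] := IHs us v vs.
exists (fun n => if n == m then k else a n); rewrite big_cons eqxx.
congr (_ + _); apply: eq_big_seq => n ns.
by case: eqP ns => // ->; rewrite (negPf ms).
Qed.

Lemma dim_spanv_le (A : {set N}) : (\dim (spanv phi A) <= #|A|)%N.
Proof. by rewrite (leq_trans (dim_span _)) // size_image. Qed.

Lemma dim_spanv_indep (A : {set N}) :
  (forall a, \sum_(n in A) a n *: phi n = 0 -> {in A, forall n, a n = 0}) ->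
  \dim (spanv phi A) = #|A|.
Proof.
rewrite /spanv /image_mem cardE -(size_map phi (enum A)) => indep.
apply/eqP; rewrite -/(free _).
have {}indep a : \sum_(n <- enum A) a n *: phi n = 0 ->
    {in enum A, forall n, a n = 0}.
  by rewrite big_enum => a0 n; rewrite mem_enum; apply: indep.
elim: (enum A) (enum_uniq A) indep => [|m s IHs] /=; first by rewrite nil_free.
move=> /andP[ms us] indep; rewrite free_cons; apply/andP; split; last first.
  apply: IHs => // a a0 n ns.
  have := indep (fun n => if n == m then 0 else a n).
  rewrite big_cons eqxx scale0r add0r (eq_big_seq (fun n => a n *: phi n)); last first.
    by move=> l ls; case: eqP ls ms => // -> ->.
  move=> /(_ a0 n); rewrite inE ns orbT => /(_ isT).
  by case: eqP ns ms => // -> ->.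
apply/negP => ms'.
have : phi m \in spanv phi [set n in s].
  rewrite /spanv (@eq_span _ _ _ [seq phi n | n <- s]) // => z.
  apply/imageP/mapP => -[n ns ->]; exists n => //; by rewrite inE in ns *.
move=> /spanvP[a am].
have := indep (fun n => if n == m then -1 else a n).
rewrite big_cons eqxx scaleN1r (eq_big_seq (fun n => a n *: phi n)); last first.
  by move=> l ls; case: eqP ls ms => // -> ->.
have -> : \sum_(n <- s) a n *: phi n = phi m.
  rewrite am (big_uniq _ us) /=; apply: eq_bigl => n; by rewrite inE.
rewrite addNr => /(_ erefl m); rewrite mem_head eqxx => /(_ isT)/eqP.
by rewrite oppr_eq0 oner_eq0.
Qed.

(* Two dependencies that are not proportional on [x], [y] would express both
   [phi x] and [phi y] through the other vectors, lowering the dimension. *)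
Lemma dependency_minor a b x y :
    \dim (spanv phi K) = (#|K| - 1)%N ->
    \sum_(n in K) a n *: phi n = 0 -> \sum_(n in K) b n *: phi n = 0 ->
  x \in K -> y \in K -> x != y -> a x * b y = a y * b x.
Proof.
wlog suff wlg : x y a b / \dim (spanv phi K) = (#|K| - 1)%N ->
    \sum_(n in K) a n *: phi n = 0 -> \sum_(n in K) b n *: phi n = 0 ->
    x \in K -> y \in K -> x != y -> a x * b y != a y * b x ->
    phi x \in spanv phi (K :\ x :\ y).
  move=> dimK a0 b0 xK yK xy; apply/eqP/negPn/negP => ab.
  have xs := wlg x y a b dimK a0 b0 xK yK xy ab.
  have ys : phi y \in spanv phi (K :\ x :\ y).
    rewrite setDDl setUC -setDDl.
    apply: (wlg y x b a) => //; first by rewrite eq_sym.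
    by rewrite mulrC [b x * _]mulrC.
  have : (spanv phi K <= spanv phi (K :\ x :\ y))%VS.
    apply/span_subvP => _ /imageP[n nK ->].
    have [->//|nx] := eqVneq n x; have [->//|ny] := eqVneq n y.
    by apply: spanv_mem; rewrite !inE nx ny.
  move=> /dimvS; rewrite dimK => /leq_trans/(_ (dim_spanv_le _)).
  rewrite (cardsD1 x K) xK (cardsD1 y (K :\ x)) !inE eq_sym xy yK /=.
  by rewrite add1n subn1 /= add1n ltnn.
move=> dimK a0 b0 xK yK xy ab.
pose d n := b y * a n - a y * b n.
have d0 : \sum_(n in K) d n *: phi n = 0.
  under eq_bigr do rewrite scalerBl -!scalerA.
  by rewrite sumrB -!scaler_sumr a0 b0 !scaler0 subrr.
have dx : d x != 0 by rewrite /d subr_eq0 mulrC.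
have dy : d y = 0 by rewrite /d mulrC subrr.
rewrite (bigD1 x) //= (bigD1 y) /= ?yK 1?eq_sym // dy scale0r add0r in d0.
have -> : phi x = \sum_(n in K :\ x :\ y) (- (d x)^-1 * d n) *: phi n.
  apply: (scalerI dx); rewrite scaler_sumr.
  move/eqP: d0; rewrite addr_eq0 => /eqP ->; rewrite -sumrN.
  apply: eq_big => [n|n _]; first by rewrite !inE andbC [(n != x) && _]andbC.
  by rewrite scalerA mulrA mulrN mulfV // mulN1r scaleNr.
by apply: memv_suml => n nK; rewrite memvZ // spanv_mem.
Qed.

(* The projection [A - Gram] onto the dependencies has rank 1; its diagonal
   entries [A - S] are positive, and its 2 x 2 minors force them to be 1. *)
Lemma regular_simplex_gram (S : R) :
    0 < S -> {in K, forall x, dot (phi x) (phi x) = S} ->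
    {in K &, forall x y, x != y -> dot (phi x) (phi y) ^+ 2 = 1} ->
    regular_simplex phi K ->
  #|K|%:R = S + 1 /\
  {in K & &, forall x y z, x != y -> y != z -> x != z ->
    dot (phi x) (phi y) * dot (phi y) (phi z) * dot (phi x) (phi z) = -1}.
Proof.
move=> S_gt0 dotS dotC1 [[K0 _ _ [A A_gt0 frame]] dimK].
(* Column [m] of [A - Gram]; the frame identity at [phi m] makes it a dependency. *)
pose a m n := A *+ (n == m) - dot (phi n) (phi m).
have a_dep m : m \in K -> \sum_(n in K) a m n *: phi n = 0.
  move=> mK; under eq_bigr do rewrite scalerBl.
  rewrite sumrB frame ?spanv_mem // (bigD1 m) //= eqxx big1 ?addr0 ?subrr // => n.
  by move=> /andP[_ /negPf ->]; rewrite scale0r.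
have axx x : x \in K -> a x x = A - S by move=> xK; rewrite /a eqxx dotS.
have axy x y : x != y -> a x y = - dot (phi x) (phi y).
  by move=> xy; rewrite /a eq_sym (negPf xy) sub0r dotC.
have minor m l x y : m \in K -> l \in K -> x \in K -> y \in K -> x != y ->
    a m x * a l y = a m y * a l x.
  by move=> mK lK; apply: dependency_minor => //; apply: a_dep.
have [x0 x0K] := set0Pn _ K0.
(* A minor needs a second point: on a singleton the span would have dimension 0, forcing
   [phi x0 = 0] against [0 < S]. *)
have [y0 y0K xy0] : exists2 y, y \in K & y != x0.
  have [Kx|/subsetPn[y yK]] := boolP (K \subset [set x0]); last first.
    by rewrite inE; exists y.
  have K00 : spanv phi K = 0%VS.
    apply/eqP; rewrite -dimv_eq0 dimK subn_eq0 -(cards1 x0); exact: subset_leq_card.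
  move: (spanv_mem x0K) (dotS _ x0K) S_gt0.
  by rewrite K00 memv0 => /eqP ->; rewrite dot0r => <-; rewrite ltxx.
have AS2 : (A - S) ^+ 2 = 1.
  have := minor y0 x0 y0 x0 y0K x0K y0K x0K xy0.
  rewrite !axx // !axy // 1?eq_sym // mulrNN -!expr2 => ->.
  by rewrite [dot (phi x0) _]dotC -expr2 dotC1.
(* Pairing column [x0] with [phi x0] gives a diagonal entry of (A - G)^2 = A (A - G). The entries of
   that column all square to 1, so the sum of squares counts [K]; its positivity then rules out
   [A - S = -1]. *)
have sumK : A * (A - S) = #|K|%:R.
  have : dot (phi x0) (\sum_(n in K) a x0 n *: phi n) = 0 by rewrite a_dep ?dot0r.
  rewrite dot_sumr => e.
  have {e} : \sum_(n in K) (a x0 n * (A *+ (n == x0)) - a x0 n ^+ 2) = 0.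
    by rewrite -[RHS]e; apply: eq_bigr => n _; rewrite /a [dot (phi x0) _]dotC; ring.
  rewrite sumrB => /eqP; rewrite subr_eq0 => /eqP.
  rewrite (bigD1 x0) //= eqxx big1 ?addr0 => [|n /andP[_ /negPf ->]]; last first.
    by rewrite mulr0.
  rewrite axx // mulrC => ->; rewrite -sum1_card natr_sum.
  apply: eq_bigr => n nK; have [->|nx] := eqVneq n x0; first by rewrite axx.
  by rewrite axy 1?eq_sym // sqrrN dotC1 // eq_sym.
have AS : A - S = 1.
  have : 0 < A - S.
    rewrite -(pmulr_rgt0 _ A_gt0) sumK ltr0n card_gt0; exact: K0.
  move=> AS_gt0; apply/eqP; move/eqP: AS2.
  by rewrite sqrf_eq1 => /orP[//|/eqP AS1]; move: AS_gt0; rewrite AS1 oppr_gt0 ltr10.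
split; first by rewrite -sumK AS mulr1 -AS addrC subrK.
move=> x y z xK yK zK xy yz xz.
have := minor x z x y xK zK xK yK xy.
rewrite axx // AS mul1r !axy // 1?eq_sym //.
rewrite (dotC (phi z) (phi y)) (dotC (phi z) (phi x)) => yzE.
have -> : dot (phi y) (phi z) = - (dot (phi x) (phi y) * dot (phi x) (phi z)).
  by rewrite -mulrNN -yzE opprK.
by rewrite mulrN mulNr mulrA -expr2 -mulrA -expr2 !dotC1 // mulr1.
Qed.

(** The Gram matrix is #K I - s s^T with |s|^2 = #K: it kills [s] and is #K times the identity on
    the complement of [s]. So [s] gives the only relation, and #K is the frame constant. *)
Lemma gram_regular_simplex (S : R) (s : N -> R) :
    0 < S -> #|K|%:R = S + 1 ->
    {in K, forall x, dot (phi x) (phi x) = S} -> {in K, forall x, s x ^+ 2 = 1} ->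
    {in K &, forall x y, x != y -> dot (phi x) (phi y) = - (s x * s y)} ->
  regular_simplex phi K.
Proof.
move=> S_gt0 cardK dotS s2 dots.
have gram : {in K &, forall x y,
    dot (phi x) (phi y) = #|K|%:R *+ (x == y) - s x * s y}.
  move=> x y xK yK; have [<-|/dots ->//] := eqVneq x y; last by rewrite sub0r.
  by rewrite dotS // -expr2 s2 // cardK addrK.
have gramsum a x : x \in K -> \sum_(n in K) a n * dot (phi x) (phi n) =
    #|K|%:R * a x - s x * \sum_(n in K) a n * s n.
  move=> xK; rewrite mulr_sumr.
  rewrite (eq_bigr (fun n => a n * (#|K|%:R *+ (x == n)) - s x * (a n * s n))).
    rewrite sumrB (bigD1 x) //= eqxx big1 ?addr0 1?mulrC // => n.
    by rewrite eq_sym => /andP[_ /negPf ->]; rewrite mulr0.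
  by move=> n nK; rewrite gram // mulrBr; congr (_ - _); ring.
have K_neq0 : #|K|%:R != 0 :> R by rewrite cardK gt_eqF // addr_gt0.
have sums2 : \sum_(n in K) s n * s n = #|K|%:R.
  by rewrite -sum1_card natr_sum; apply: eq_bigr => n nK; rewrite -expr2 s2.
have us0 : \sum_(n in K) s n *: phi n = 0.
  apply: dot_eq0; rewrite dot_sumr big1 // => n nK.
  by rewrite dotC dot_sumr gramsum // sums2 [s n * #|K|%:R]mulrC subrr mulr0.
have K_gt0 : K != set0.
  by apply: contraNneq K_neq0 => ->; rewrite cards0.
have [z zK] := set0Pn _ K_gt0.
have sz : s z != 0.
  by rewrite -sqrf_eq0 s2 // oner_eq0.
split; first split => //.
- by exists S.
- exists 1 => // x y xK yK xy.
  by rewrite dots // normrN -normrX exprMn !s2 // mulr1 normr1.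
- exists #|K|%:R; first by rewrite cardK addr_gt0.
  move=> _ /spanvP[a ->].
  rewrite (eq_bigr (fun n =>
    (#|K|%:R * a n) *: phi n - (\sum_(m in K) a m * s m) *: (s n *: phi n))).
    rewrite sumrB -scaler_sumr us0 scaler0 subr0 scaler_sumr.
    by apply: eq_bigr => n _; rewrite scalerA.
  move=> n nK; rewrite dot_sumr gramsum // scalerBl.
  by rewrite [s n * _]mulrC scalerA.
(* The relation [us0] has a nonzero coefficient at [z], so dropping [z] keeps the span. *)
have <- : spanv phi (K :\ z) = spanv phi K.
  apply/eqP; rewrite eqEsubv; apply/andP; split; apply/span_subvP => _ /imageP[n nK ->].
    by apply: spanv_mem; move: nK; rewrite inE => /andP[].
  have [->|nz] := eqVneq n z; last by rewrite spanv_mem // !inE nz.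
  have -> : phi z = \sum_(n in K :\ z) (- (s z)^-1 * s n) *: phi n.
    apply: (scalerI sz); move/eqP: us0.
    rewrite (bigD1 z) //= addr_eq0 => /eqP ->.
    rewrite scaler_sumr -sumrN; apply: eq_big => [m|m _]; first by rewrite !inE andbC.
    by rewrite scalerA mulrA mulrN mulfV // mulN1r scaleNr.
  by apply: memv_suml => m mK; rewrite memvZ // spanv_mem.
rewrite dim_spanv_indep; first by rewrite (cardsD1 z K) zK addKn.
move=> a a0 n nK.
(* A relation on [K :\ z], extended by 0 at [z], is a multiple of [s]; its value at [z] shows that
   the multiple is zero. *)
pose a' m := if m == z then 0 else a m.
have a'0 : \sum_(m in K) a' m *: phi m = 0.
  rewrite (bigD1 z) //= /a' eqxx scale0r add0r -[RHS]a0.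
  apply: eq_big => [m|m /andP[_ /negPf ->]//]; by rewrite !inE andbC.
pose t := \sum_(m in K) a' m * s m.
have a'E x : x \in K -> #|K|%:R * a' x = s x * t.
  move=> xK; apply/eqP; rewrite -subr_eq0 -gramsum // -dot_sumr a'0 dot0r.
  exact/eqP.
have t0 : t = 0.
  have /eqP := a'E z zK; rewrite /a' eqxx mulr0 eq_sym mulf_eq0 (negPf sz).
  by move/eqP.
move: nK; rewrite !inE => /andP[nz nK].
have /eqP := a'E n nK; rewrite t0 mulr0 mulf_eq0 (negPf K_neq0) /a' (negPf nz).
by move/eqP.
Qed.

End Simplices.

(** * Arithmetic of the two-element field and its sign character *)

Lemma F2_eq1 (a : 'F_2) : (a == 1) = (a != 0).
Proof. by case: a => [[|[|[]]]]. Qed.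

Lemma F2P (a : 'F_2) : {a = 0} + {a = 1}.
Proof. by have [->|] := eqVneq a 0; [left | rewrite -F2_eq1 => /eqP; right]. Qed.

Lemma F2_eq1_inj (a b : 'F_2) : (a == 1) = (b == 1) -> a = b.
Proof. by case: (F2P a) (F2P b) => -> [] ->. Qed.

Lemma F2_addaa (a : 'F_2) : a + a = 0.
Proof. by case: (F2P a) => ->; apply/eqP. Qed.

Definition F2_sign (R : nzRingType) (a : 'F_2) : R := (-1) ^+ nat_of_ord a.

Lemma F2_signD (R : nzRingType) a b :
  F2_sign R (a + b) = F2_sign R a * F2_sign R b.
Proof.
by case: (F2P a) (F2P b) => -> [] ->;
  rewrite /F2_sign /= ?expr0 ?expr1 ?mulrNN ?mulr1 ?mul1r.
Qed.

Lemma F2_sign_sqr (R : nzRingType) a : F2_sign R a ^+ 2 = 1.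
Proof. by rewrite /F2_sign sqrr_sign. Qed.

Lemma F2_signN1 (R : numDomainType) a : F2_sign R a = -1 -> a = 1.
Proof.
by case: (F2P a) => -> //; rewrite /F2_sign expr0 => /eqP; rewrite eq_sym eqNr oner_eq0.
Qed.

(** * Symplectic forms over the two-element field *)

Section Forms.
Variables (V : finZmodType) (b : V -> V -> 'F_2).
Hypothesis addvv : forall x : V, x + x = 0.
Hypothesis formDl : forall x y z, b (x + y) z = b x z + b y z.
Hypothesis formC : forall x y, b x y = b y x.
Hypothesis formxx : forall x, b x x = 0.
Hypothesis form_nondeg : forall x, (forall y, b x y = 0) -> x = 0.
Implicit Types (E K S : {set V}) (x y z u v w : V).

Lemma addvK x y : x + y + y = x. Proof. by rewrite -addrA addvv addr0. Qed.

Lemma addvI x y : x + y = 0 -> x = y.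
Proof. by move=> xy; rewrite -[x](addvK x y) xy add0r. Qed.

Lemma form_addr x y z : b x (y + z) = b x y + b x z.
Proof. by rewrite formC formDl !(formC x). Qed.

Lemma form0r x : b x 0 = 0.
Proof. by have := form_addr x x x; rewrite addvv formxx addr0. Qed.

Lemma form_suml S y : b (\sum_(x in S) x) y = \sum_(x in S) b x y.
Proof.
apply: (big_morph (b^~ y)) => [u v|]; first exact: formDl.
by rewrite formC form0r.
Qed.

Definition pairwise1 E := {in E &, forall x y, x != y -> b x y = 1}.

(** The condition that triple products of Gram entries are -1, written additively: each value of [q]
    occurs twice in such a product and cancels. *)
Definition odd_triangles K :=
  {in K & &, forall x y z, x != y -> y != z -> x != z -> b x y + b y z + b x z = 1}.

(** Every element of [S] other than [y] contributes 1 and [y] itself contributes 0. *)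
Lemma pairwise1_sum E S y : pairwise1 E -> S \subset E -> y \in E ->
  (b (\sum_(x in S) x) y == 1) = odd #|S| (+) (y \in S).
Proof.
move=> E1 SE yE; rewrite form_suml (big_setID [set y]) /= big1 => [|x]; last first.
  by rewrite !inE => /andP[_ /eqP ->]; rewrite formxx.
rewrite add0r (eq_bigr (fun=> 1)) => [|x]; last first.
  by rewrite !inE => /andP[xy xS]; rewrite E1 // (subsetP SE).
rewrite sumr_const (cardsD1 y S) oddD oddb addbAC addbb /=.
by rewrite -Fp_nat_mod // modn2; case: odd.
Qed.

(* The Gram matrix J - I of an even number of vectors is invertible mod 2, so
   the vectors are independent. *)
Lemma pairwise1_sum_inj E : pairwise1 E -> ~~ odd #|E| ->
  {in powerset E &, injective (fun S => \sum_(x in S) x)}.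
Proof.
move=> E1 Eeven S T; rewrite !inE => SE TE /= ST.
have par y : y \in E -> odd #|S| (+) (y \in S) = odd #|T| (+) (y \in T).
  by move=> yE; rewrite -!(pairwise1_sum E1) // ST.
have out (U : {set V}) y : U \subset E -> y \notin E -> (y \in U) = false.
  by move=> /subsetP UE; apply: contraNF; apply: UE.
have [oST|oST] := eqVneq (odd #|S|) (odd #|T|).
  apply/setP => y; have [yE|yE] := boolP (y \in E).
    by have := par y yE; rewrite oST => /addbI.
  by rewrite (out S) // (out T).
(* If the parities differ, all memberships are opposite; then #S + #T = #E would be odd. *)
have TES : T = E :\: S.
  apply/setP => y; rewrite inE; have [yE|yE] := boolP (y \in E); last first.
    by rewrite andbF (out T).
  by have := par y yE; move: oST; do 2!case: odd; do 2!case: (y \in _).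
move: Eeven oST; rewrite -(setIidPr SE) TES -(cardsID S E) oddD.
by rewrite setIC; do 2!case: odd.
Qed.

Lemma pairwise1_card E : pairwise1 E -> ~~ odd #|E| -> (2 ^ #|E| <= #|V|)%N.
Proof.
move=> E1 Eeven; rewrite -card_powerset.
by rewrite -(card_in_imset (pairwise1_sum_inj E1 Eeven)) max_card.
Qed.

(** By counting, the subset sums of [E] exhaust [V], so orthogonality to [E] is orthogonality to
    everything. *)
Lemma pairwise1_nondeg E u : pairwise1 E -> ~~ odd #|E| -> #|V| = (2 ^ #|E|)%N ->
  {in E, forall x, b u x = 0} -> u = 0.
Proof.
move=> E1 Eeven cardV u0; apply: form_nondeg => y.
have : y \in [set \sum_(x in S) x | S : {set V} in powerset E].
  suff -> : [set \sum_(x in S) x | S : {set V} in powerset E] = setT by rewrite inE.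
  apply/eqP; rewrite eqEcard subsetT cardsT cardV -card_powerset.
  by rewrite (card_in_imset (pairwise1_sum_inj E1 Eeven)) leqnn.
case/imsetP => S /[!inE] SE ->; rewrite formC form_suml big1 // => x xS.
by rewrite formC u0 // (subsetP SE).
Qed.

(** Sending [w] to the part of [E] where [b w] is 1 is injective by nondegeneracy, hence onto the
    subsets of [E] by counting. *)
Lemma pairwise1_represent E (g : V -> 'F_2) :
    pairwise1 E -> ~~ odd #|E| -> #|V| = (2 ^ #|E|)%N ->
  exists w, {in E, forall x, b w x = g x}.
Proof.
move=> E1 Eeven cardV; pose f w := [set x in E | b w x == 1].
have f_inj : injective f.
  move=> u v /setP fuv; apply: addvI.
  apply: (pairwise1_nondeg E1 Eeven cardV) => x xE.
  have := fuv x; rewrite !inE xE formDl /= => /F2_eq1_inj ->.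
  exact: F2_addaa.
have : [set x in E | g x == 1] \in [set f w | w : V].
  suff -> : [set f w | w : V] = powerset E.
    by rewrite inE; apply/subsetP => x; rewrite inE => /andP[].
  apply/eqP; rewrite eqEcard card_powerset card_imset // cardV leqnn andbT.
  apply/subsetP => _ /imsetP[w _ ->]; rewrite inE.
  by apply/subsetP => x /[!inE] /andP[].
case/imsetP => w _ /setP gw; exists w => x xE.
by have := gw x; rewrite !inE xE /= => /F2_eq1_inj.
Qed.

(** The form of [x + z] and [y + z] is exactly the triangle sum of [x], [y], [z]. *)
Lemma odd_triangles_translate K z : odd_triangles K -> z \in K ->
  pairwise1 [set x + z | x in K :\ z].
Proof.
move=> Ktri zK _ _ /imsetP[x xK ->] /imsetP[y yK ->].
move: xK yK; rewrite !inE => /andP[xz xK] /andP[yz yK] xy.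
rewrite formDl !form_addr formxx addr0 (formC z y) addrAC.
by apply: Ktri => //; apply: contra_neq xy => ->.
Qed.

Lemma odd_triangles_card K : odd_triangles K -> (2 <= #|K|)%N -> ~~ odd #|K| ->
  (2 ^ (#|K| - 2) <= #|V|)%N.
Proof.
move=> Ktri K2 Keven.
have /card_gt0P[z zK] : (0 < #|K|)%N by apply: leq_trans K2.
set E := [set x + z | x in K :\ z].
have cardE : #|E| = (#|K| - 1)%N.
  by rewrite card_imset; [rewrite (cardsD1 z K) zK addKn | apply: addIr].
have /card_gt0P[e eE] : (0 < #|E|)%N by rewrite cardE subn_gt0.
(* The translate has odd size #K - 1; one more point goes because independence needs an even
   size. *)
have cardEe : #|E :\ e| = (#|K| - 2)%N.
  by rewrite -[2%N]/(1 + 1)%N subnDA -cardE (cardsD1 e E) eE addKn.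
rewrite -cardEe; apply: pairwise1_card; last first.
  by rewrite cardEe oddB // (negPf Keven).
move=> x y; rewrite !inE => /andP[_ xE] /andP[_ yE].
exact: (odd_triangles_translate Ktri zK).
Qed.

(** * Character sums of quadratic functions *)

Section Quadratic.
Variable q : V -> 'F_2.
Hypothesis qD : forall x y, q (x + y) = q x + q y + q 0 + b x y.
Let D := [set x | q x == 0].

Lemma notin_zeros x : (x \in ~: D) = (q x == 1).
Proof. by rewrite !inE F2_eq1. Qed.

Section CharacterSums.
Variable R : numDomainType.
Local Notation sg := (F2_sign R).

(** Translating by some [t] with [b t u = 1] negates the sum. *)
Lemma sum_form_sign u : u != 0 -> \sum_w sg (b w u) = 0.
Proof.
move=> u0; have /existsP[t tu] : [exists t, b t u == 1].
  apply: contraNT u0 => /existsPn tu; apply/eqP/form_nondeg => t.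
  by apply/eqP; rewrite formC; have := tu t; rewrite F2_eq1 negbK.
have : \sum_w sg (b w u) = - \sum_w sg (b w u).
  rewrite [LHS](reindex_inj (addIr t)) -sumrN; apply: eq_bigr => w _ /=.
  by rewrite formDl F2_signD (eqP tu) /F2_sign expr1 mulrN1.
by move/eqP; rewrite -addr_eq0 -mulr2n mulrn_eq0 /= => /eqP.
Qed.

Lemma sum_quad_sign : \sum_w sg (q w) = 2 * #|D|%:R - #|V|%:R.
Proof.
rewrite -sum1_card -[#|V|]sum1_card !natr_sum mulr_sumr.
rewrite (big_mkcond (mem D)) -sumrB; apply: eq_bigr => w _; rewrite !inE.
by case: (F2P (q w)) => ->; rewrite /F2_sign /=; ring.
Qed.

(** Completing the square: q(w) + b(w,u) = q(w + u) + q(u) + q(0). *)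
Lemma sum_quad_form_sign u :
  \sum_w sg (q w) * sg (b w u) = sg (q u + q 0) * (2 * #|D|%:R - #|V|%:R).
Proof.
rewrite -sum_quad_sign [in RHS](reindex_inj (addIr u)) mulr_sumr.
apply: eq_bigr => w _ /=.
rewrite qD -!F2_signD; congr sg.
by case: (F2P (q w)) (F2P (q u)) (F2P (q 0)) (F2P (b w u))
  => -> [] -> [] -> [] ->; apply/eqP.
Qed.

(** Twice the indicator of [D] is 1 + (-1)^q. *)
Lemma sum_zeros_form_sign u :
  2 * \sum_(w in D) sg (b w u) =
  #|V|%:R *+ (u == 0) + sg (q u + q 0) * (2 * #|D|%:R - #|V|%:R).
Proof.
rewrite -sum_quad_form_sign.
have -> : #|V|%:R *+ (u == 0) = \sum_w sg (b w u).
  have [->|/sum_form_sign -> //] := eqVneq u 0.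
  rewrite -sum1_card natr_sum; apply: eq_bigr => w _.
  by rewrite form0r /F2_sign.
rewrite -big_split /= mulr_sumr big_mkcond; apply: eq_bigr => w _.
by rewrite !inE; case: (F2P (q w)) => ->; rewrite /F2_sign /=; ring.
Qed.

End CharacterSums.

(** Four times the indicator of the pair is the product of 1 - (-1)^q at [w] and at [w + v]. Its
    cross term is, up to sign, the character of [b w v], which sums to zero. *)
Lemma nonzeros_autocorrelation v : v != 0 ->
  (4 * #|[set x in ~: D | (x + v)%R \in ~: D]| + #|V| = 4 * #|~: D|)%N.
Proof.
move=> v0; pose sg := F2_sign int.
have e4 : 4 * #|[set x in ~: D | x + v \in ~: D]|%:R =
    \sum_w (1 - sg (q w) - sg (q (w + v)) + sg (q w) * sg (q (w + v))) :> int.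
  rewrite -sum1_card natr_sum mulr_sumr big_mkcond; apply: eq_bigr => w _.
  rewrite !inE -!F2_eq1.
  by case: (F2P (q w)) (F2P (q (w + v))) => -> [] ->; rewrite /sg /F2_sign.
have s1 : \sum_w sg (q (w + v)) = 2 * #|D|%:R - #|V|%:R.
  by rewrite -sum_quad_sign [RHS](reindex_inj (addIr v)).
have s2 : \sum_w sg (q w) * sg (q (w + v)) = 0.
  rewrite (eq_bigr (fun w => sg (q v + q 0) * sg (b w v))) => [|w _].
    by rewrite -mulr_sumr sum_form_sign // mulr0.
  rewrite -!F2_signD qD; congr sg.
  by case: (F2P (q w)) (F2P (q v)) (F2P (q 0)) (F2P (b w v))
    => -> [] -> [] -> [] ->; apply/eqP.
move: e4; rewrite big_split /= s2 addr0 !sumrB s1 sum_quad_sign.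
have -> : \sum_(w : V) 1 = #|V|%:R :> int by rewrite -sum1_card natr_sum.
rewrite !natz; have := cardsC D.
move: #|D| #|~: D| #|V| #|[set _ in _ | _]| => d c n k; lia.
Qed.

End Quadratic.

(** * Sets in which each nonzero vector is the sum of exactly two ordered pairs *)

Section Cap.
Variable A : {set V}.
Hypothesis autoA : forall v, v != 0 -> #|[set x in A | x + v \in A]| = 2%N.

(** Otherwise [x], [y] and [z] would be three points of [A] that stay in [A] under translation by
    [x + y]. *)
Lemma sum3_notin x y z : x \in A -> y \in A -> z \in A ->
  x != y -> y != z -> x != z -> x + y + z \notin A.
Proof.
move=> xA yA zA xy yz xz; apply/negP => xyzA.
have : (#|[set x; y; z]| <= 2)%N.
  rewrite -(autoA (_ : x + y != 0)); last by apply: contra_neq xy => /addvI.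
  apply/subset_leq_card/subsetP => _ /setUP[/set2P[]|/set1P] ->; rewrite inE.
  - by rewrite xA addrA addvv add0r.
  - by rewrite yA addrCA addvv addr0.
  - by rewrite zA addrC.
by rewrite -setUA cardsU1 cards2 !inE (negPf xz) (negPf xy) yz.
Qed.

Hypothesis cardA : (2 < #|A|)%N.

(** Equal translates make all of [A] invariant under [u + v], but only two points may stay in
    [A]. *)
Lemma translate_inj : injective (fun v => [set v + x | x in A]).
Proof.
move=> u v /= uv; apply/eqP/negPn/negP => nuv.
suff : A \subset [set x in A | x + (u + v) \in A].
  move/subset_leq_card; rewrite autoA; first by rewrite leqNgt cardA.
  by apply: contra_neq nuv => /addvI.
apply/subsetP => x xA; rewrite inE xA.
have : u + x \in [set v + y | y in A] by rewrite -uv imset_f.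
case/imsetP => y yA uxy; rewrite addrA [x + u]addrC uxy.
by rewrite addrAC addvv add0r.
Qed.

Lemma mem_translate v x : (x \in [set v + y | y in A]) = (v + x \in A).
Proof.
apply/imsetP/idP => [[y yA ->]|vxA]; first by rewrite addrA addvv add0r.
by exists (v + x); rewrite // addrA addvv add0r.
Qed.

(** The block of [v] contains [x] iff v = x + a with [a] in [A]; it also contains [y] iff a + (x +
    y) is in [A], which leaves two choices of [a]. *)
Lemma translates_BIBD :
  forms_BIBD #|V| #|A| 2 #|A| #|V| [set [set v + x | x in A] | v : V].
Proof.
exists [seq [set v + x | x in A] | v <- enum V]; split.
- by rewrite map_inj_uniq ?enum_uniq //; apply: translate_inj.
- by move=> S; apply/mapP/imsetP => -[v _ ->]; exists v => //; rewrite mem_enum.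
split=> //.
- rewrite size_map -cardE; split=> //.
  by apply: leq_trans (max_card (mem A)); apply: leq_trans cardA.
- split=> [_ /mapP[v _ ->]|]; last exact: ltnW.
  by rewrite card_imset //; apply: addrI.
- move=> x y xy; rewrite count_map -(autoA (_ : x + y != 0)); last first.
    by apply: contra_neq xy => /addvI.
  rewrite -size_filter -(card_imset _ (addrI x)) cardE; apply: perm_size.
  apply: uniq_perm => [||v]; [exact/filter_uniq/enum_uniq|exact: enum_uniq|].
  rewrite mem_filter !mem_enum andbT /= !mem_translate -[v in RHS](addvK v x).
  rewrite [v + x + x]addrC mem_imset; last exact: addrI.
  by rewrite inE addrA addvK.
move=> x; rewrite count_map -size_filter -(card_imset _ (addrI x)) cardE.
apply: perm_size; apply: uniq_perm => [||v]; [exact/filter_uniq/enum_uniq|exact: enum_uniq|].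
by rewrite mem_filter !mem_enum andbT /= !mem_translate addrC.
Qed.

End Cap.

Lemma odd_triangles6_translate (q : V -> 'F_2) (K : {set V})
    (A := ~: [set x | q x == 0]) :
    (forall x y, q (x + y) = q x + q y + q 0 + b x y) ->
    (forall v, v != 0 -> #|[set x in A | x + v \in A]| = 2%N) ->
    #|V| = 16%N -> #|A| = 6%N -> odd_triangles K -> #|K| = 6%N ->
  exists v, K = [set v + x | x in A].
Proof.
move=> qD autoA cardV cardA Ktri cardK.
have memA x : (x \in A) = (q x == 1) by rewrite notin_zeros.
have /card_gt0P[z zK] : (0 < #|K|)%N by rewrite cardK.
have := odd_triangles_translate Ktri zK; set E := [set _ | x in _] => E1.
have cardE : #|E| = 5%N.
  rewrite card_imset; last exact: addIr.
  by apply/eqP; rewrite -(eqn_add2l (z \in K)) -cardsD1 zK cardK.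
have memE x : x \in K -> x != z -> x + z \in E.
  by move=> xK xz; apply/imsetP; exists x; rewrite // !inE xz.
have := mem_enum E; have := enum_uniq E; move: cardE; rewrite cardE.
case: (enum E) => [|e5 [|e1 [|e2 [|e3 [|e4 []]]]]] //= _.
rewrite !inE !negb_or andbT => /and4P[/and4P[n51 n52 n53 n54] /and3P[n12 n13 n14]].
move=> /andP[n23 n24] n34 Eenum.
have [E_1 E_2 E_3 E_4 E_5] : [/\ e1 \in E, e2 \in E, e3 \in E, e4 \in E & e5 \in E].
  by rewrite -!Eenum !inE !eqxx !orbT.
pose E4 := [set e1; e2; e3; e4].
have E4E : {subset E4 <= E} by move=> x; rewrite !inE -!orbA => /or4P[] /eqP ->.
have cardE4 : #|E4| = 4%N.
  rewrite /E4 -!setUA !cardsU1 cards1 !inE !negb_or.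
  by rewrite n12 n13 n14 n23 n24 n34.
have E41 : pairwise1 E4 by move=> x y xE yE; apply: E1; apply: E4E.
have even4 : ~~ odd #|E4| by rewrite cardE4.
have cardV4 : #|V| = (2 ^ #|E4|)%N by rewrite cardV cardE4.
have [m1 m2 m3 m4] : [/\ e1 \in E4, e2 \in E4, e3 \in E4 & e4 \in E4].
  by rewrite !inE !eqxx !orbT.
(* Both sides pair to 1 with each of [e1], ..., [e4]: on the right three terms contribute 1. *)
have e5E : e5 = e1 + e2 + e3 + e4.
  apply: addvI; apply: (pairwise1_nondeg E41 even4 cardV4) => x xE4.
  have xE := E4E x xE4.
  rewrite !formDl (E1 e5) //; last first.
    by move: xE4; rewrite !inE -!orbA => /or4P[] /eqP ->.
  move: xE4; rewrite !inE -!orbA => /or4P[] /eqP ->;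
    rewrite formxx !E1 // 1?eq_sym //; exact/eqP.
(* [q] is constant on [w + E], so that [w + z] translates [K] into [A] as soon
   as [q w = 1]. *)
have [w wE4] := pairwise1_represent (fun x => q x + q 0) E41 even4 cardV4.
have qwD x : x \in E -> q (w + x) = q w.
  move=> xE; have [xE4|xE4] := boolP (x \in E4).
    by rewrite qD wE4 // -[q w + _ + _]addrA -addrA F2_addaa addr0.
  have -> : x = e5.
    move: xE4 xE; rewrite -Eenum !inE -!orbA !negb_or.
    by move=> /and4P[/negPf -> /negPf -> /negPf -> /negPf ->] /[!orbF] /eqP.
  (* The choice of [w] cancels the values of [q], and the six products of distinct [e1], ..., [e4]
     add up to 0. *)
  rewrite e5E !qD !form_addr !formDl !wE4 // !E1 //.
  by case: (F2P (q w)) (F2P (q e1)) (F2P (q e2)) (F2P (q e3)) (F2P (q e4))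
    (F2P (q 0)) => -> [] -> [] -> [] -> [] -> [] ->; apply/eqP.
have qwDD x y : x \in E4 -> y \in E4 -> x != y -> q (w + x + y) = q w + 1.
  move=> xE yE xy; rewrite !qD formDl !wE4 // E41 //.
  by case: (F2P (q w)) (F2P (q x)) (F2P (q y)) (F2P (q 0))
    => -> [] -> [] -> [] ->; apply/eqP.
(* Otherwise the four points [w + e1 + e2], [w + e1 + e3], [w + e2 + e4],
   [w + e3 + e4] of [A] would sum to zero. *)
have qw : q w = 1.
  case: (F2P (q w)) => // qw0.
  have inA x y : x \in E4 -> y \in E4 -> x != y -> w + x + y \in A.
    by move=> xE yE xy; rewrite memA qwDD // qw0 add0r.
  have := sum3_notin autoA (inA _ _ m1 m2 n12) (inA _ _ m1 m3 n13) (inA _ _ m2 m4 n24).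
  have -> : w + e1 + e2 + (w + e1 + e3) + (w + e2 + e4) = w + e3 + e4.
    by rewrite (addrACA (w + e1)) addvv add0r addrACA (addrCA e2) addvv addr0 addrA.
  rewrite inA //= => H; suff : false by []; apply: H.
  - by apply: contra_neq n23 => /addrI.
  (* Pairing with [e1] separates the points: [e1 + e3] gives 1 and [e2 + e4] gives 0. *)
  - rewrite -!addrA (inj_eq (addrI w)); apply/eqP => /(congr1 (b^~ e1)) /=.
    by rewrite !formDl formxx !E1 // 1?eq_sym // => /eqP.
  - rewrite addrAC (addrAC w e2); apply: contra_neq n14.
    by rewrite -!addrA => /addrI; rewrite !(addrC e2) => /addIr.
exists (w + z); apply/eqP; rewrite eqEcard card_imset; last exact: addrI.
rewrite cardA cardK leqnn andbT; apply/subsetP => x xK.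
rewrite mem_translate memA -addrA (addrC z).
have [->|xz] := eqVneq x z; first by rewrite addvv addr0 qw.
by rewrite qwD ?qw // memE.
Qed.

End Forms.

(** * The Gram matrix of [Phi] and its regular simplices *)

Section PhiGram.
Variables (R : realType) (J : nat) (V : vectType 'F_2).
Local Notation fV := (finvect_type V).
Variables (B : fV -> fV -> 'F_2) (q : fV -> 'F_2).
Let D := [set x | q x == 0].
Local Notation phi := (Phi R J B D).
Local Notation sg := (F2_sign R).

Hypothesis formDl : forall x y z, B (x + y) z = B x z + B y z.
Hypothesis formC : forall x y, B x y = B y x.
Hypothesis formxx : forall x, B x x = 0.
Hypothesis form_nondeg : forall x, (forall y, B x y = 0) -> x = 0.
Hypothesis qD : forall x y, q (x + y) = q x + q y + q 0 + B x y.
Hypothesis J_gt0 : (0 < J)%N.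
Hypothesis cardV : #|fV| = (2 ^ (2 * J))%N.
Hypothesis cardD : #|D| = (2 ^ (J - 1) * (2 ^ J + 1))%N.

Lemma F2_vect_addvv (x : fV) : x + x = 0.
Proof. by rewrite -mulr2n -scaler_nat (_ : 2%:R = 0) ?scale0r //; apply/eqP. Qed.
Let addvv := F2_vect_addvv.

Lemma dot_Phi x y :
  dot (phi x) (phi y) = 2 ^+ J *+ (x == y) + sg (B x y + q x + q y).
Proof.
have two_neq0 : 2 != 0 :> R by rewrite pnatr_eq0.
have -> : dot (phi x) (phi y) = (2 ^+ (J - 1))^-1 * \sum_(w in D) sg (B w (x + y)).
  rewrite (big_sub (mem D)) mulr_sumr; apply: eq_bigr => w _; rewrite !ffunE.
  rewrite (form_addr formDl formC) F2_signD mulrACA; congr (_ * _).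
  by rewrite -invfM -expr2 -exprM mulnC exprM sqr_sqrtr.
have := sum_zeros_form_sign addvv formDl formC formxx form_nondeg qD R (x + y).
have -> : (x + y == 0) = (x == y).
  by apply/eqP/eqP => [/(addvI addvv)//|->]; rewrite addvv.
have -> : q (x + y) + q 0 = B x y + q x + q y.
  rewrite qD; case: (F2P (q x)) (F2P (q y)) (F2P (q 0)) (F2P (B x y))
    => -> [] -> [] -> [] ->; exact/eqP.
have eJ : (2 : R) ^+ J = 2 * 2 ^+ (J - 1) by rewrite -exprS subn1 prednK.
have eV : #|fV|%:R = 2 ^+ J * 2 ^+ J :> R by rewrite cardV natrX mul2n -addnn exprD.
(* The size of [D] fixes the sign of the character sum: 2^J (2^J + 1) - 2^(2J) = +2^J. *)
have -> : 2 * #|[set x | q x == 0]|%:R - #|fV|%:R = 2 ^+ J :> R.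
  rewrite -/D eV cardD natrM natrD !natrX mulrA -eJ mulrDr mulr1.
  by rewrite [_ + 2 ^+ J]addrC addrK.
rewrite eV -mulrnAr => e.
apply: (mulfI (_ : 2 ^+ J != 0)); first by rewrite expf_neq0.
rewrite mulrA {1}eJ mulfK ?expf_neq0 // e; rewrite mulrDr mulrnAr.
by congr (_ + _); rewrite mulrC.
Qed.

Lemma dot_Phi_sqr x y : x != y -> dot (phi x) (phi y) ^+ 2 = 1.
Proof. by move=> /negPf xy; rewrite dot_Phi xy add0r F2_sign_sqr. Qed.

Lemma dot_Phi_diag x : dot (phi x) (phi x) = 2 ^+ J + 1.
Proof.
by rewrite dot_Phi eqxx formxx add0r F2_addaa.
Qed.

Lemma regular_simplex_Phi K :
  regular_simplex phi K <-> #|K| = (2 ^ J + 2)%N /\ odd_triangles B K.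
Proof.
have S_gt0 : 0 < 2 ^+ J + 1 :> R by rewrite addr_gt0 // exprn_gt0.
have dotN x y : x != y -> dot (phi x) (phi y) = sg (B x y + q x + q y).
  by move=> /negPf xy; rewrite dot_Phi xy add0r.
have sg3 x y z : sg (B x y + q x + q y) * sg (B y z + q y + q z) *
    sg (B x z + q x + q z) = sg (B x y + B y z + B x z).
  rewrite -!F2_signD; congr sg.
  by case: (F2P (q x)) (F2P (q y)) (F2P (q z)) (F2P (B x y)) (F2P (B y z))
    (F2P (B x z)) => -> [] -> [] -> [] -> [] -> [] ->; apply/eqP.
have natS : (2 ^ J + 2)%:R = 2 ^+ J + 1 + 1 :> R.
  by rewrite natrD natrX -addrA.
split=> [simp|[cardK tri]].
  have [||cardK tri] := regular_simplex_gram S_gt0 _ _ simp.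
  - by move=> x _; apply: dot_Phi_diag.
  - by move=> x y _ _; apply: dot_Phi_sqr.
  split; first by apply/eqP; rewrite -(eqr_nat R) cardK natS.
  move=> x y z xK yK zK xy yz xz; apply: (@F2_signN1 R).
  by rewrite -sg3 -!dotN // tri.
have /card_gt0P[z zK] : (0 < #|K|)%N by rewrite cardK addn_gt0 orbT.
(* Signs normalised at the base point [z]: the Gram entries at [z] fit by definition, the others by
   the triple condition. *)
pose s x := if x == z then 1 else - sg (B x z + q x + q z).
apply: (gram_regular_simplex (s := s) S_gt0).
- by rewrite cardK natS.
- by move=> x _; apply: dot_Phi_diag.
- move=> x _; rewrite /s; case: eqP => _; first exact: expr1n.
  by rewrite sqrrN F2_sign_sqr.
move=> x y xK yK xy; rewrite dotN // /s.
have [xz|xz] := eqVneq x z.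
  by rewrite -xz eq_sym (negPf xy) mul1r opprK formC addrAC.
have [->|yz] := eqVneq y z; first by rewrite mulr1 opprK.
rewrite mulrNN; set c := sg (B x z + _ + _); set d := sg (B y z + _ + _).
have := sg3 x y z; rewrite tri // -/c -/d => e.
rewrite -[LHS]mulr1 -(F2_sign_sqr R (B y z + q y + q z)) -/d expr2 mulrA.
rewrite -[LHS]mulr1 -(F2_sign_sqr R (B x z + q x + q z)) -/c expr2.
by rewrite mulrA (mulrAC _ d c) e /F2_sign expr1 mulN1r mulNr mulrC.
Qed.

End PhiGram.

(** Passing to the complement replaces [Q] by [Q + 1]; the term [q 0] absorbs the constant, so both
    cases get one equation. *)
Lemma affine_quadric_zeros (V : vectType 'F_2)
    (B : finvect_type V -> finvect_type V -> 'F_2) (D : {set finvect_type V}) :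
    B 0 0 = 0 -> affine_quadric B D ->
  exists2 q : finvect_type V -> 'F_2,
    (forall x y, q (x + y) = q x + q y + q 0 + B x y) & D = [set x | q x == 0].
Proof.
move=> B00 [Q QB DQ].
have Q0 : Q 0 = 0 by have := QB 0 0; rewrite addr0 F2_addaa add0r B00.
have [c ->] : exists c, D = [set x | Q x + c == 0].
  case: DQ => [->|/(congr1 (@setC _))].
    by exists 0; apply/setP => x; rewrite !inE addr0.
  rewrite setCK => ->; exists 1; apply/setP => x; rewrite !inE.
  by case: (F2P (Q x)) => ->.
exists (fun x => Q x + c) => // x y; rewrite Q0 QB.
by case: (F2P (Q (x + y))) (F2P (Q x)) (F2P (Q y)) (F2P c)
  => -> [] -> [] -> [] ->; apply/eqP.
Qed.

(** * The binders for J > 2 and for J = 2 *)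

Theorem theorem5p7 (R : realType) (J : nat) (V : vectType 'F_2)
    (B : {skew_symmetric (finvect_type V)}) (D : {set finvect_type V})
    (hJ : (2 <= J)%N)
    (dimV : \dim {:V} = (2 * J)%N)
    (Bsymp : is_psymplectic B)
    (Dquad : affine_quadric B D)
    (cardD : #|D| = (2 ^ (J - 1) * (2 ^ J + 1))%N) :
  (J <> 2%N -> binder (Phi R J B D) (~: D) = set0) /\
  (J = 2%N ->
    [/\ #|~: D| = 6%N /\ regular_simplex (Phi R J B D) (~: D),
        binder (Phi R J B D) (~: D) = [set ~: D],
        binder (Phi R J B D) [set: finvect_type V]
          = [set shift v (~: D) | v : finvect_type V]
      & forms_BIBD 16 6 2 6 16 (binder (Phi R J B D) [set: finvect_type V])]).
Proof.
have [nondeg _ alt] := Bsymp.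
have addvv := @F2_vect_addvv V.
have formDl x y z : B (x + y) z = B x z + B y z by rewrite linearDl.
have formxx x : B x x = 0 by apply: alt; exact: pchar_Fp.
have formC x y : B x y = B y x.
  by rewrite hermC /= expr1 mulN1r; case: (F2P (B y x)) => ->; apply/eqP.
have form_nondeg x : (forall y, B x y = 0) -> x = 0.
  move=> Bx; apply/eqP; rewrite -memv0 -(eqP nondeg).
  by apply/mem_orthovP => y _; apply: Bx.
have cardV : #|finvect_type V| = (2 ^ (2 * J))%N.
  rewrite -(card_vspacef (Vector.class (finvect_type V))) card_vspace card_Fp //.
  exact: (congr1 (expn 2) dimV).
have J_gt0 : (0 < J)%N by apply: leq_trans hJ.
have [q qD Dq] := affine_quadric_zeros (formxx 0) Dquad.
subst D.
have simplexP := regular_simplex_Phi R formDl formC formxx form_nondeg qD J_gt0 cardV cardD.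
set D := [set x | q x == 0] in cardD simplexP *.
have in_binder (A K : {set finvect_type V}) : (K \in binder (Phi R J B D) A) ->
    [/\ K \subset A, #|K| = (2 ^ J + 2)%N & odd_triangles B K].
  by rewrite inE => /andP[KA /asboolP/simplexP[]].
split=> [J2|J2].
  have J3 : (3 <= J)%N by rewrite ltn_neqAle hJ andbT eq_sym; apply/eqP.
  apply/setP => K; rewrite [RHS]inE; apply/negP => /in_binder[_ cardK tri].
  have := odd_triangles_card addvv formDl formC formxx tri.
  have evenK : ~~ odd #|K| by rewrite cardK oddD oddX /= orbF addbF -lt0n.
  (* Here #K - 2 = 2^J, so the bound reads 2^J <= 2J; the induction below refutes it from J = 3
     on. *)
  rewrite evenK cardK addnK leq_addl cardV leq_exp2l // leqNgt => /(_ isT isT).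
  move=> /negP; apply; move: J3 {J2 hJ dimV cardD cardV simplexP in_binder J_gt0 cardK}.
  elim: J => // -[|[|[|n]]] // IH _.
  by have := IH isT; rewrite [in X in _ -> X]expnS; lia.
subst J; have {}cardV : #|finvect_type V| = 16%N by rewrite cardV.
have cardA : #|~: D| = 6%N.
  have := cardsC D; rewrite cardD cardV => /eqP.
  by rewrite -[16%N]/(10 + 6)%N eqn_add2l => /eqP.
(* The autocorrelation identity becomes 4n + 16 = 24. *)
have autoA v : v != 0 -> #|[set x in ~: D | x + v \in ~: D]| = 2%N.
  move=> v0; have := nonzeros_autocorrelation formDl formC form_nondeg qD v0.
  rewrite -/D cardA cardV; move: #|[set _ in _ | _]| => n; lia.
have translate_simplex v : regular_simplex (Phi R 2 B D) [set v + x | x in ~: D].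
  apply/simplexP; rewrite card_imset; last exact: addrI.
  split; first by rewrite cardA.
  move=> _ _ _ /imsetP[x xA ->] /imsetP[y yA ->] /imsetP[z zA ->].
  rewrite !(inj_eq (addrI v)) => xy yz xz.
  (* Thus q(x + y + z) = 0, while its expansion is 1 + 1 + 1 plus the triangle sum of [x], [y], [z];
     shifting by [v] leaves that sum unchanged. *)
  have : x + y + z \notin ~: D by apply: sum3_notin.
  have [/eqP qx /eqP qy /eqP qz] : [/\ q x == 1, q y == 1 & q z == 1].
    by rewrite -!notin_zeros.
  rewrite !inE negbK !qD qx qy qz !formDl !linearDr /= !formxx.
  rewrite (formC y v) (formC x v) => /eqP.
  case: (F2P (B v x)) (F2P (B v y)) (F2P (B v z)) (F2P (B x y)) (F2P (B y z))
    (F2P (B x z)) (F2P (q 0))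
    => -> [] -> [] -> [] -> [] -> [] -> [] -> //= *; exact/eqP.
have simplexA : regular_simplex (Phi R 2 B D) (~: D).
  have := translate_simplex 0; rewrite (eq_imset (g := id)) ?imset_id // => x.
  exact: add0r.
have binderT : binder (Phi R 2 B D) [set: finvect_type V] =
    [set shift v (~: D) | v : finvect_type V].
  apply/setP => K; apply/idP/imsetP => [/in_binder[_ cardK tri]|[v _ ->]].
    have [v ->] := odd_triangles6_translate addvv formDl formC formxx form_nondeg
      qD autoA cardV cardA tri cardK.
    by exists v.
  by rewrite inE subsetT; apply/asboolP/translate_simplex.
split=> //.
  apply/setP => K; rewrite [RHS]inE; apply/idP/eqP => [/in_binder[KA cardK _]|->].
    by apply/eqP; rewrite eqEcard KA cardA cardK.
  by rewrite inE subxx; apply/asboolP.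
have := translates_BIBD addvv autoA; rewrite binderT cardA cardV.
exact.
Qed.
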